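(* Let $n\ge 2$, $m\ge 1$ and let $\mathcal{M}=\{M_1,\dots,M_m\}\subseteq\mathbb{R}^{n\times n}$ be a finite set of $m$ (possibly singular) matrices. Then the stabilizability radius $\tilde\rho=\tilde\rho(\mathcal{M})$ and the joint spectral subradius $\check\rho=\check\rho(\mathcal{M})$ satisfy $$\frac{\check\rho}{m}\le\tilde\rho\le\check\rho .$$
   Context: For a finite set $\mathcal{M}=\{M_1,\dots,M_m\}\subseteq\mathbb{R}^{n\times n}$, consider the discrete-time switched system $x(t+1)=M_{\sigma(t)}x(t)$, $x(0)=x_0\in\mathbb{R}^n$, where the switching law $\sigma(\cdot)$ takes values in $\{1,\dots,m\}$ and may depend on $x_0$. The stabilizability radius is $$\tilde\rho(\mathcal{M})=\sup_{x_0\in\mathbb{R}^n}\inf\{\lambda\ge 0 \mid \exists\,\sigma(\cdot),\ c>0 \text{ such that } \|x(t)\|\le c\lambda^t\|x_0\|\ \ \forall t\ge 0\}.$$ Let $\mathcal{M}^T$ be the set of all products $M_{\sigma(T)}\cdots M_{\sigma(1)}$ of length $T$ of matrices from $\mathcal{M}$. The joint spectral subradius is $\check\rho(\mathcal{M})=\lim_{T\to\infty}\inf_{A\in\mathcal{M}^T}\|A\|^{1/T}$ (independent of the norm). *)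

(* Defs.v *)
From HB Require Import structures.
From mathcomp Require Import all_boot all_order all_algebra.
From mathcomp Require Import all_classical all_reals all_analysis.

Set Implicit Arguments.
Unset Strict Implicit.
Unset Printing Implicit Defensive.

Import Order.TTheory GRing.Theory Num.Theory.
Import numFieldNormedType.Exports.

Local Open Scope classical_set_scope.
Local Open Scope ring_scope.

Definition is_norm (R : realType) (V : lmodType R) (N : V -> R) : Prop :=
  [/\ forall x y, N (x + y) <= N x + N y,
      forall (a : R) x, N (a *: x) = `|a| * N x
    & forall x, N x = 0 -> x = 0].

(* The set {M_1, ..., M_m} is given by its indexing; repetitions are allowed.
   A switching law is a function nat -> 'I_m. *)

Fixpoint trajectory (R : realType) (n m : nat) (M : 'I_m -> 'M[R]_n)
    (sigma : nat -> 'I_m) (x0 : 'cV[R]_n) (t : nat) : 'cV[R]_n :=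
  if t is t'.+1 then M (sigma t') *m trajectory M sigma x0 t' else x0.

(* M_{sigma(T-1)} ... M_{sigma(0)} *)
Fixpoint switched_product (R : realType) (n m : nat) (M : 'I_m -> 'M[R]_n)
    (sigma : nat -> 'I_m) (T : nat) : 'M[R]_n :=
  if T is T'.+1 then M (sigma T') *m switched_product M sigma T' else 1%:M.

Definition products (R : realType) (n m : nat) (M : 'I_m -> 'M[R]_n)
    (T : nat) : set 'M[R]_n :=
  [set switched_product M sigma T | sigma in [set: nat -> 'I_m]].

Definition stabilizing_rates (R : realType) (n m : nat) (N : 'cV[R]_n -> R)
    (M : 'I_m -> 'M[R]_n) (x0 : 'cV[R]_n) : set R :=
  [set lambda | 0 <= lambda /\
     exists (sigma : nat -> 'I_m) (c : R), 0 < c /\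
       forall t, N (trajectory M sigma x0 t) <= c * lambda ^+ t * N x0].

(* For 0 < m every set of rates is nonempty, and the infima are bounded
   uniformly in x0, so the real-valued inf and sup are not default values. *)
Definition stabilizability_radius (R : realType) (n m : nat)
    (N : 'cV[R]_n -> R) (M : 'I_m -> 'M[R]_n) : R :=
  sup [set inf (stabilizing_rates N M x0) | x0 in [set: 'cV[R]_n]].

(* The value at T = 0 (where T%:R^-1 = 0) does not affect the limit. *)
Definition joint_spectral_subradius (R : realType) (n m : nat)
    (N : 'M[R]_n -> R) (M : 'I_m -> 'M[R]_n) : R :=
  limn (fun T : nat => inf [set N A `^ (T%:R^-1) | A in products M T]).

(* Main.v *)
(* Upper bound: if lambda exceeds the joint spectral subradius, repeating one
   good product periodically drives every initial state at rate lambda.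

   Lower bound: let every x0 be driven at rate lambda by some law. By Baire's
   theorem there are k and a ball such that for every x in the ball and every t
   some word w of length t satisfies |M_w x| <= k lambda^t. There are only m^t
   words, so on a grid of N^n points of the ball with N = m^t + 1 one word w
   serves more than N^(n-1) points, hence two points on a common line in each
   coordinate direction e_j. Their difference is at least of order 1/N, so
   |M_w e_j| = O(N lambda^t) for all j, that is |M_w| = O((m lambda)^t). *)

Require Import Defs.
From HB Require Import structures.
From mathcomp Require Import all_boot all_order all_algebra.
From mathcomp Require Import all_classical all_reals all_analysis.
From mathcomp Require Import ring lra.

Import Order.TTheory GRing.Theory Num.Theory.
Import numFieldNormedType.Exports.

Local Open Scope ring_scope.

Set Implicit Arguments.
Unset Strict Implicit.

(** * Equivalence of norms on matrices *)

Section Norms.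
Context {R : realType}.

Lemma is_norm0 (V : lmodType R) (N : V -> R) : is_norm N -> N 0 = 0.
Proof. by case=> _ NZ _; rewrite -(scale0r 0) NZ normr0 mul0r. Qed.

Lemma is_normN (V : lmodType R) (N : V -> R) x : is_norm N -> N (- x) = N x.
Proof. by case=> _ NZ _; rewrite -scaleN1r NZ normrN1 mul1r. Qed.

Lemma is_norm_ge0 (V : lmodType R) (N : V -> R) x : is_norm N -> 0 <= N x.
Proof.
move=> hN; have [ND _ _] := hN.
by have := ND x (- x); rewrite subrr is_norm0 // is_normN // -mulr2n pmulrn_lge0.
Qed.

Lemma is_norm_sum (V : lmodType R) (N : V -> R) (I : Type) (r : seq I)
    (P : pred I) (F : I -> V) :
  is_norm N -> N (\sum_(i <- r | P i) F i) <= \sum_(i <- r | P i) N (F i).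
Proof.
move=> hN; have [ND _ _] := hN; elim/big_rec2: _ => [|i y x _ xy].
  by rewrite is_norm0.
exact: le_trans (ND _ _) (lerD _ _).
Qed.

Lemma is_norm_dist (V : lmodType R) (N : V -> R) x y :
  is_norm N -> `|N x - N y| <= N (x - y).
Proof.
move=> hN; have [ND _ _] := hN.
rewrite ler_norml; apply/andP; split.
  rewrite lerNl opprB lerBlDr -(is_normN (x - y) hN) opprB.
  by rewrite -{1}(subrK x y) ND.
by rewrite lerBlDr -{1}(subrK y x) ND.
Qed.

(** Here [|A|] is the max norm, the largest absolute value of an entry; every other norm is compared
    with it. *)
Lemma mx_entry_le (p q : nat) (A : 'M[R]_(p, q)) i j : `|A i j| <= `|A|.
Proof.
rewrite [leRHS]/Num.Def.normr /= mx_normrE.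
exact: (le_bigmax _ (fun ij => `|A ij.1 ij.2|) (i, j)).
Qed.

Lemma mx_norm_le (p q : nat) (A : 'M[R]_(p, q)) e :
  0 <= e -> (forall i j, `|A i j| <= e) -> `|A| <= e.
Proof.
move=> e0 Ae; rewrite [leLHS]/Num.Def.normr /= mx_normrE.
by apply: bigmax_le => // -[i j] _; exact: Ae.
Qed.

Lemma mx_norm_mul (p q r : nat) (A : 'M[R]_(p, q)) (B : 'M[R]_(q, r)) :
  `|A *m B| <= q%:R * `|A| * `|B|.
Proof.
apply: mx_norm_le => [|i j]; first by rewrite !mulr_ge0.
rewrite mxE; apply: le_trans (ler_norm_sum _ _ _) _.
have -> : q%:R * `|A| * `|B| = \sum_(k < q) `|A| * `|B|.
  by rewrite sumr_const card_ord -[RHS]mulr_natl mulrA.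
by apply: ler_sum => k _; rewrite normrM ler_pM // mx_entry_le.
Qed.

(** Expanding [A] in the matrix units bounds [N A] by [|A|] times the sum of the norms of the
    units. *)
Lemma is_norm_le_mx_norm (p q : nat) (N : 'M[R]_(p, q) -> R) :
  is_norm N -> exists2 C, 0 < C & forall A, N A <= C * `|A|.
Proof.
move=> hN; have [_ NZ _] := hN.
pose S := \sum_i \sum_j N (delta_mx i j : 'M[R]_(p, q)).
have S0 : 0 <= S.
  by apply: sumr_ge0 => i _; apply: sumr_ge0 => j _; exact: is_norm_ge0.
(* The [+ 1] keeps the constant positive for empty matrices. *)
exists (S + 1) => [|A]; first by rewrite ltr_wpDl.
apply: (@le_trans _ _ (S * `|A|)); last by rewrite ler_wpM2r // lerDl.
rewrite {1}(matrix_sum_delta A) mulr_suml.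
apply: le_trans (is_norm_sum _ _ _ hN) _; apply: ler_sum => i _.
rewrite mulr_suml.
apply: le_trans (is_norm_sum _ _ _ hN) _; apply: ler_sum => j _.
by rewrite NZ mulrC ler_wpM2l ?mx_entry_le // is_norm_ge0.
Qed.

Lemma lipschitz_continuous (V : normedModType R) (f : V -> R) (C : R) :
  0 < C -> (forall x y, `|f x - f y| <= C * `|x - y|) -> continuous f.
Proof.
move=> C0 fC x; apply/(@cvgrPdist_lt R R^o) => e e0; apply/nbhs_normP.
exists (e / C) => [/=|y]; first by rewrite divr_gt0.
by rewrite /= ltr_pdivlMr // mulrC; apply: le_lt_trans.
Qed.

(** Used with word products for [A]: it makes the sets fed to Baire's theorem closed. *)
Lemma is_norm_mulmx_continuous (p q r : nat) (N : 'M[R]_(p, r) -> R)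
    (A : 'M[R]_(p, q)) :
  is_norm N -> continuous (fun B : 'M[R]_(q, r) => N (A *m B)).
Proof.
move=> hN; have [C C0 NC] := is_norm_le_mx_norm hN.
apply: (@lipschitz_continuous _ _ (C * (q%:R * `|A| + 1))) => [|B B'].
  by rewrite mulr_gt0 // ltr_wpDl // mulr_ge0.
apply: le_trans (is_norm_dist _ _ hN) _; rewrite -mulmxBr.
apply: le_trans (NC _) _; rewrite -mulrA ler_pM2l //.
by apply: le_trans (mx_norm_mul _ _) _; rewrite ler_wpM2r // lerDl.
Qed.

Lemma is_norm_continuous (p q : nat) (N : 'M[R]_(p, q) -> R) :
  is_norm N -> continuous N.
Proof.
move=> hN; have -> : N = fun A => N (1%:M *m A).
  by apply/funext => A; rewrite mul1mx.
exact: is_norm_mulmx_continuous.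
Qed.

(** The continuous [N] attains a minimum on the compact unit sphere of the max norm; it is positive
    by definiteness, and its inverse is the constant. [mx_norm_le_is_norm] reduces matrices to row
    vectors by flattening. *)
Lemma rV_norm_le_is_norm (p : nat) (N : 'rV[R]_p -> R) :
  is_norm N -> exists2 C, 0 < C & forall v, `|v| <= C * N v.
Proof.
move=> hN; have [_ NZ N0] := hN.
pose S := [set v : 'rV[R]_p | `|v| = 1]%classic.
have scaleS v : v != 0 -> S (`|v|^-1 *: v).
  by move=> v0; rewrite /S /= normrZ normfV normr_id mulVf // normr_eq0.
have [S0|nS] := pselect (S !=set0)%classic; last first.
  (* Empty sphere: every vector is 0, so any constant works. *)
  exists 1 => // v; have [->|v0] := eqVneq v 0.
    by rewrite normr0 mul1r is_norm_ge0.
  by case: nS; exists (`|v|^-1 *: v); exact: scaleS.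
have Scompact : compact S.
  apply: bounded_closed_compact.
    by exists 1; split=> // x x1 v; rewrite /S /= => ->; exact: ltW.
  rewrite (_ : S = (fun v : 'rV[R]_p => `|v|) @^-1` [set 1])%classic //.
  by apply: preimage_closed => // v _; exact: norm_continuous.
have [c cS cmin] : exists2 c, c \in S & forall v, v \in S -> N c <= N v.
  apply: compact_EVT_min => //.
  exact/continuous_subspaceT/is_norm_continuous.
have Nc0 : 0 < N c.
  rewrite lt_neqAle is_norm_ge0 // andbT eq_sym; apply/eqP => /N0 c0.
  by move: cS; rewrite inE /S /= c0 normr0 => /esym/eqP; rewrite oner_eq0.
exists (N c)^-1 => [|v]; first by rewrite invr_gt0.
have [->|v0] := eqVneq v 0; first by rewrite normr0 mulr_ge0 ?invr_ge0 ?is_norm_ge0.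
have := cmin _ (mem_set (scaleS v v0)); rewrite NZ normfV normr_id.
by rewrite ler_pdivlMl ?normr_gt0 // mulrC -ler_pdivlMl // mulrC.
Qed.

Lemma mx_norm_le_is_norm (p q : nat) (N : 'M[R]_(p, q) -> R) :
  is_norm N -> exists2 C, 0 < C & forall A, `|A| <= C * N A.
Proof.
move=> [ND NZ N0].
have [|C C0 NC] := @rV_norm_le_is_norm _ (fun v => N (vec_mx v)).
  split=> [x y|a x|x /N0 x0]; first by rewrite linearD ND.
    by rewrite linearZ NZ.
  by rewrite -(vec_mxK x) x0 linear0.
exists C => // A; have := NC (mxvec A); rewrite mxvecK; apply: le_trans.
by apply: mx_norm_le => // i j; rewrite -mxvecE mx_entry_le.
Qed.

(** An arbitrary norm need not be submultiplicative; equivalence with the max norm makes it so up to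
    a factor [K], even across different norms. *)
Lemma is_norm_mulmx (p q r : nat) (N1 : 'M[R]_(p, q) -> R)
    (N2 : 'M[R]_(q, r) -> R) (N3 : 'M[R]_(p, r) -> R) :
  is_norm N1 -> is_norm N2 -> is_norm N3 ->
  exists2 K, 0 < K & forall A B, N3 (A *m B) <= K * N1 A * N2 B.
Proof.
move=> hN1 hN2 hN3.
have [C1 C10 H1] := mx_norm_le_is_norm hN1.
have [C2 C20 H2] := mx_norm_le_is_norm hN2.
have [C3 C30 H3] := is_norm_le_mx_norm hN3.
exists (C3 * (q.+1%:R * C1 * C2)) => [|A B]; first by rewrite !mulr_gt0.
apply: le_trans (H3 _) _.
apply: (@le_trans _ _ (C3 * (q.+1%:R * (`|A| * `|B|)))).
  rewrite ler_pM2l //; apply: le_trans (mx_norm_mul _ _) _.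
  by rewrite -mulrA ler_wpM2r ?mulr_ge0 // ler_nat.
rewrite [leRHS](_ : _ = C3 * (q.+1%:R * (C1 * N1 A * (C2 * N2 B)))); last by ring.
by rewrite !ler_pM2l // ler_pM.
Qed.

(** Every entry of [A] lies in a column [A *m delta_mx j 0], so bounding the images of the basis
    vectors bounds [A]. *)
Lemma is_norm_columns (p q : nat) (Nv : 'cV[R]_p -> R) (N : 'M[R]_(p, q) -> R) :
  is_norm Nv -> is_norm N -> exists2 K, 0 < K &
  forall A e, 0 <= e -> (forall j, Nv (A *m delta_mx j 0) <= e) -> N A <= K * e.
Proof.
move=> hNv hN.
have [C1 C10 H1] := mx_norm_le_is_norm hNv.
have [C2 C20 H2] := is_norm_le_mx_norm hN.
exists (C2 * C1) => [|A e e0 Ae]; first exact: mulr_gt0.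
apply: le_trans (H2 _) _; rewrite -mulrA ler_pM2l //.
apply: mx_norm_le => [|i j]; first by rewrite mulr_ge0 // ltW.
have -> : A i j = (A *m delta_mx j 0) i (0 : 'I_1) by rewrite -colE mxE.
apply: le_trans (mx_entry_le _ _ _) _; apply: le_trans (H1 _) _.
by rewrite ler_pM2l.
Qed.

End Norms.

(** * Growth rates of products and the joint spectral subradius *)

Section Rates.
Context {R : realType}.
Local Open Scope classical_set_scope.
Local Open Scope ring_scope.

(** [(a / b) ^+ t] tends to 0. Any constant factor is thus absorbed, for large [t], by a slightly
    larger rate. *)
Lemma geometric_dominated (a b C : R) :
  0 <= a -> a < b -> \forall t \near \oo, C * a ^+ t <= b ^+ t.
Proof.
move=> a0 ab; have b0 : 0 < b by exact: le_lt_trans ab.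
have ab1 : `|a / b| < 1.
  by rewrite ger0_norm ?divr_ge0 ?(ltW b0) // ltr_pdivrMr // mul1r.
have := cvg_geometric C ab1; move=> /cvgrPdist_le /(_ 1 ltr01).
apply: filterS => t /=; rewrite sub0r normrN => /(le_trans (ler_norm _)).
by rewrite expr_div_n mulrA ler_pdivrMr ?exprn_gt0 // mul1r.
Qed.

Lemma powR_invn_exprn (a : R) (T : nat) :
  (0 < T)%N -> 0 <= a -> (a ^+ T) `^ (T%:R^-1) = a.
Proof.
move=> T0 a0; rewrite -powR_mulrn // -powRrM mulfV ?powRr1 //.
by rewrite pnatr_eq0 -lt0n.
Qed.

Context {n m : nat} (M : 'I_m -> 'M[R]_n).

Lemma eq_switched_product (sigma tau : nat -> 'I_m) (T : nat) :
  (forall t, (t < T)%N -> sigma t = tau t) ->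
  switched_product M sigma T = switched_product M tau T.
Proof.
elim: T => //= T IH st; rewrite st // IH // => t tT.
by apply: st; exact: leq_trans tT _.
Qed.

Lemma switched_productD (sigma : nat -> 'I_m) (s t : nat) :
  switched_product M sigma (s + t) =
  switched_product M (fun k => sigma (s + k)%N) t *m switched_product M sigma s.
Proof.
elim: t => [|t IH]; first by rewrite addn0 mul1mx.
by rewrite addnS /= IH mulmxA.
Qed.

Lemma trajectoryE (sigma : nat -> 'I_m) (x : 'cV[R]_n) (t : nat) :
  trajectory M sigma x t = switched_product M sigma t *m x.
Proof. by elim: t => [|t /= ->]; rewrite ?mul1mx ?mulmxA. Qed.

Context (N : 'M[R]_n -> R) (hN : is_norm N) (hm : (0 < m)%N).

Lemma products_nonempty (T : nat) : (products M T !=set0).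
Proof.
exists (switched_product M (fun=> Ordinal hm) T).
by exists (fun=> Ordinal hm).
Qed.

Context (K : R) (K0 : 0 < K) (NK : forall A B, N (A *m B) <= K * N A * N B).

(** When the first [T] letters of [sigma] are repeated, each period multiplies the norm bound by at
    most [lambda ^+ T], so [C] only has to cover [t < T]. *)
Lemma periodic_law_rate (sigma : nat -> 'I_m) (T : nat) (lambda : R) :
  (0 < T)%N -> 0 < lambda -> K * N (switched_product M sigma T) <= lambda ^+ T ->
  exists (tau : nat -> 'I_m) (C : R), 0 < C /\
    forall t, N (switched_product M tau t) <= C * lambda ^+ t.
Proof.
move=> T0 l0 KN; pose tau t := sigma (t %% T)%N.
pose f t := N (switched_product M tau t).
have f0 t : 0 <= f t by exact: is_norm_ge0.
have fT t : f (T + t)%N <= lambda ^+ T * f t.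
  rewrite /f switched_productD; apply: le_trans (NK _ _) _.
  rewrite (@eq_switched_product _ tau t) => [|k _]; last by rewrite /tau modnDl.
  rewrite (@eq_switched_product tau sigma T) => [|k kT]; last first.
    by rewrite /tau modn_small.
  by rewrite mulrAC ler_wpM2r // f0.
(* One term of the sum covers each [r < T]; the 1 gives positivity. *)
pose C := 1 + \sum_(r < T) f r / lambda ^+ r.
have C0 : 0 < C.
  by rewrite ltr_pwDl // sumr_ge0 // => r _; rewrite divr_ge0 // exprn_ge0 // ltW.
exists tau, C; split=> // t; rewrite -/(f t).
elim/ltn_ind: t => t IH; have [tT|Tt] := ltnP t T.
  rewrite -ler_pdivrMr ?exprn_gt0 // /C (bigD1 (Ordinal tT)) //= addrCA lerDl.
  rewrite addr_ge0 // sumr_ge0 // => r _.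
  by rewrite divr_ge0 // exprn_ge0 // ltW.
rewrite -(subnKC Tt); apply: le_trans (fT _) _.
rewrite exprD mulrCA ler_pM2l ?exprn_gt0 // IH // ltn_subrL T0.
exact: leq_trans Tt.
Qed.

Let u (T : nat) : R := inf [set N A `^ (T%:R^-1) | A in products M T].

Lemma root_inf_lbound (T : nat) :
  has_lbound [set N A `^ (T%:R^-1) | A in products M T].
Proof. by exists 0 => _ [A _ <-]; exact: powR_ge0. Qed.

Lemma root_inf_ge0 (T : nat) : 0 <= u T.
Proof.
apply: lb_le_inf; last by move=> _ [A _ <-]; exact: powR_ge0.
by have [A PA] := products_nonempty T; exists (N A `^ (T%:R^-1)); exists A.
Qed.

Lemma root_inf_le (T : nat) (A : 'M[R]_n) (lambda : R) :
  (0 < T)%N -> 0 <= lambda -> products M T A -> N A <= lambda ^+ T -> u T <= lambda.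
Proof.
move=> T0 l0 PA NA; apply: (@le_trans _ _ (N A `^ (T%:R^-1))).
  by apply: ge_inf; [exact: root_inf_lbound | exists A].
rewrite -[leRHS](powR_invn_exprn T0 l0) ge0_ler_powR ?invr_ge0 ?ler0n //.
  by rewrite nnegrE is_norm_ge0.
by rewrite nnegrE exprn_ge0.
Qed.

Lemma root_inf_ge (T : nat) (lambda : R) :
  (0 < T)%N -> 0 <= lambda ->
  (forall A, products M T A -> lambda ^+ T <= N A) -> lambda <= u T.
Proof.
move=> T0 l0 NA; apply: lb_le_inf.
  by have [A PA] := products_nonempty T; exists (N A `^ (T%:R^-1)); exists A.
move=> _ [A PA <-]; rewrite -[leLHS](powR_invn_exprn T0 l0).
rewrite ge0_ler_powR ?invr_ge0 ?ler0n ?NA // nnegrE ?exprn_ge0 //.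
exact: is_norm_ge0.
Qed.

(* As in Fekete's lemma, the limit is the infimum of the rates lambda reached
   by a single product; N is submultiplicative only up to the factor K. *)
Lemma root_inf_cvg : cvgn u.
Proof.
pose S := [set l : R | 0 < l /\ exists T (sigma : nat -> 'I_m),
  (0 < T)%N /\ K * N (switched_product M sigma T) < l ^+ T].
have S0 : (S !=set0).
  pose i := Ordinal hm; pose a := K * N (switched_product M (fun=> i) 1).
  have a0 : 0 <= a by rewrite mulr_ge0 ?is_norm_ge0 // ltW.
  exists (a + 1); split; first by rewrite ltr_wpDl.
  by exists 1%N, (fun=> i); split=> //; rewrite expr1 ltrDl.
have lbS : has_lbound S by exists 0 => l [/ltW].
apply/cvg_ex; exists (inf S); apply/cvgrPdist_le => e e0.
(* A periodic law follows a rate of [S] below [inf S + e] up to a constant, which the margin absorbs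
   for large [t]. *)
have up : \forall t \near \oo, u t <= inf S + e.
  have [l [l0 [T [sigma [T0 /ltW KN]]]] le] : exists2 l, S l & l < inf S + e.
    by apply: inf_lt => //; rewrite ltrDl.
  have [tau [C [C0 NC]]] := periodic_law_rate T0 l0 KN.
  near=> t; apply: (@root_inf_le _ (switched_product M tau t)).
  - by near: t; exact: nbhs_infty_gt.
  - by rewrite ltW // (lt_trans l0).
  - by exists tau.
  - apply: le_trans (NC _) _; near: t.
    by apply: geometric_dominated; [exact: ltW | ].
have dn : \forall t \near \oo, inf S - e <= u t.
  have [le0|gt0] := leP (inf S - e) 0.
    by apply: nearW => t; exact: le_trans le0 (root_inf_ge0 t).
  (* The intermediate rate [inf S - e / 2] absorbs [K]: a product beating it would place it in [S],
     below the infimum. *)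
  have b0 : inf S - e < inf S - e / 2 by lra.
  near=> t; have t0 : (0 < t)%N by near: t; exact: nbhs_infty_gt.
  apply: root_inf_ge => //; first exact: ltW.
  move=> _ [sigma _ <-]; rewrite -(ler_pM2l K0).
  apply: (@le_trans _ _ ((inf S - e / 2) ^+ t)).
    by near: t; apply: geometric_dominated => //; exact: ltW.
  rewrite leNgt; apply/negP => lt.
  suff /(ge_inf lbS) : S (inf S - e / 2) by lra.
  by split; [lra | exists t, sigma].
near=> t; rewrite distrC ler_distl; apply/andP; split; near: t; assumption.
Unshelve. all: by end_near. Qed.

Lemma joint_spectral_subradius_ge0 : 0 <= joint_spectral_subradius N M.
Proof.
by apply: limr_ge; [exact: root_inf_cvg | apply: nearW; exact: root_inf_ge0].
Qed.

(** Taking [t]-th roots removes [C]: for each [e > 0] the terms are eventually at most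
    [lambda + e]. *)
Lemma joint_spectral_subradius_le (lambda C : R) :
  0 <= lambda ->
  (forall t, exists2 A, products M t A & N A <= C * lambda ^+ t) ->
  joint_spectral_subradius N M <= lambda.
Proof.
move=> l0 NC; apply/ler_addgt0Pr => e e0.
apply: limr_le; first exact: root_inf_cvg.
near=> t; have [A PA NA] := NC t.
apply: (@root_inf_le _ A) => //.
- by near: t; exact: nbhs_infty_gt.
- by rewrite addr_ge0 // ltW.
- apply: le_trans NA _; near: t; apply: geometric_dominated => //.
  by rewrite ltrDl.
Unshelve. all: by end_near. Qed.

(** One long product of norm below [a ^+ t], with [a] strictly between the subradius and [lambda],
    is repeated periodically; the gap between [a] and [lambda] absorbs [K]. *)
Lemma joint_spectral_subradius_lt (lambda : R) :
  joint_spectral_subradius N M < lambda ->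
  exists (sigma : nat -> 'I_m) (C : R), 0 < C /\
    forall t, N (switched_product M sigma t) <= C * lambda ^+ t.
Proof.
move=> jl; set r := joint_spectral_subradius N M in jl.
have r0 : 0 <= r by exact: joint_spectral_subradius_ge0.
pose a := (r + lambda) / 2.
have ra : r < a by rewrite /a; lra.
have al : a < lambda by rewrite /a; lra.
have a0 : 0 <= a by rewrite (le_trans r0) // ltW.
have ua : \forall t \near \oo, u t < a.
  by apply: (cvgr_lt r) => //; exact: root_inf_cvg.
near \oo => t.
have t0 : (0 < t)%N by near: t; exact: nbhs_infty_gt.
have Ka : K * a ^+ t <= lambda ^+ t by near: t; exact: geometric_dominated.
have : u t < a by near: t.
rewrite ltNge => /negP ut.
have [sigma Ns] : exists sigma, N (switched_product M sigma t) < a ^+ t.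
  apply: contrapT => /forallNP nN; apply: ut; apply: root_inf_ge => //.
  by move=> _ [sigma _ <-]; rewrite leNgt; apply/negP; exact: nN.
apply: (@periodic_law_rate sigma t lambda t0); first exact: (le_lt_trans a0 al).
by apply: le_trans Ka; rewrite ler_pM2l // ltW.
Unshelve. all: by end_near. Qed.

End Rates.

(** * Pigeonhole on a grid and Baire's theorem for closed covers *)

(* Some colour takes more than N^(n-1) points, so the projection along any
   coordinate axis is not injective on its class. *)
Lemma grid_pigeonhole (n N : nat) (T : finType) (f : {ffun 'I_n -> 'I_N} -> T) :
  (0 < n)%N -> (#|T| < N)%N ->
  exists c, forall j : 'I_n, exists g h : {ffun 'I_n -> 'I_N},
    [/\ f g = c, f h = c, g j != h j & forall i, i != j -> g i = h i].
Proof.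
case: n f => // n f _ TN; have N0 := leq_ltn_trans (leq0n _) TN.
(* The dimension is now [n.+1]. If all classes had at most [N ^ n] points, then
   [N ^ n.+1 <= #|T| * N ^ n], against [#|T| < N]. *)
have [c cN] : exists c, (N ^ n < #|[set g | f g == c]|)%N.
  apply/existsP; apply: contraLR TN => /existsPn small; rewrite -leqNgt.
  rewrite -(leq_pmul2r (_ : 0 < N ^ n)%N) ?expn_gt0 ?N0 //.
  rewrite -expnS -[X in (N ^ X)%N](card_ord n.+1) -[X in (X ^ _)%N](card_ord N).
  rewrite -card_ffun -sum1_card (partition_big f predT) //= -sum_nat_const.
  apply: leq_sum => c _; rewrite sum1_card.
  have := small c; rewrite -leqNgt; apply: leq_trans.
  by apply/eq_leq/eq_card => g; rewrite !inE.
(* [F] forgets coordinate [j]; its codomain has only [N ^ n] elements, so it identifies two distinct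
   points of the class. *)
exists c => j; pose F (g : {ffun 'I_n.+1 -> 'I_N}) := [ffun i => g (lift j i)].
have /dinjectivePn[g gc [h /andP[hg hc] Fgh]] : ~~ dinjectiveb F [set g | f g == c].
  apply: contraL cN => /dinjectiveP Finj; rewrite -leqNgt -(card_in_imset Finj).
  by apply: leq_trans (max_card _) _; rewrite card_ffun !card_ord.
exists g, h; move: gc hc; rewrite !inE => /eqP gc /eqP hc.
have gh i : i != j -> g i = h i.
  rewrite eq_sym => /unlift_some[k -> _].
  by move/ffunP/(_ k): Fgh; rewrite !ffunE.
split=> //; apply: contraNneq hg => ghj; apply/eqP/ffunP => i.
by have [->|/gh] := eqVneq i j.
Qed.

(** Otherwise all complements are open and dense, and Baire's theorem yields a point outside every
    [F k]. *)
Lemma Baire_closed_cover (R : realType) (U : completeNormedModType R)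
    (F : nat -> set U) :
  (forall k, closed (F k)) -> (forall x, exists k, F k x) ->
  exists k x r, 0 < r /\ (ball x r `<=` F k)%classic.
Proof.
move=> Fcl Fcov.
have [k /denseNE [B [[x xB] BF]]] : exists k, ~ dense (~` F k)%classic.
  apply/existsNP => Fd.
  have Fod k : open (~` F k)%classic /\ dense (~` F k)%classic.
    by split; [exact: closed_openC | exact: Fd].
  have [||x [_ Fx]] := Baire Fod (O := setT); [by exists 0 | exact: openT |].
  by have [k /(Fx k I)] := Fcov x.
have /nbhs_ballP[r r0 xr] := open_nbhs_nbhs xB.
exists k, x, r; split=> // y /xr By; apply: contrapT => Fy.
by have : (B `&` ~` F k)%classic y by []; rewrite BF.
Qed.

(* Makes HB infer the join completeNormedModType, which Baire requires. *)
HB.instance Definition _ (R : realType) (m n : nat) :=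
  Complete.on (matrix R m n).

(** * From rates of trajectories to rates of products *)

Section LowerBound.
Context {R : realType} {n m : nat} (hn : (0 < n)%N) (hm : (0 < m)%N).
Context (M : 'I_m -> 'M[R]_n).
Context (vnorm : 'cV[R]_n -> R) (hvnorm : is_norm vnorm).

(** Words are tuples so that those of length [t] form a finite type. The default letter of [nth] is
    never read, as only positions below [t] occur. *)
Let word_product (t : nat) (w : t.-tuple 'I_m) : 'M[R]_n :=
  switched_product M (nth (Ordinal hm) w) t.

Lemma word_productE (t : nat) (sigma : nat -> 'I_m) :
  word_product [tuple sigma i | i < t] = switched_product M sigma t.
Proof.
apply: eq_switched_product => s st.
by rewrite -(tnth_nth _ _ (Ordinal st)) tnth_mktuple.
Qed.

(* Baire upgrades the constants c, which depend on the initial state, to a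
   single one valid on a whole ball; the word still depends on x. *)
Lemma uniform_rate_on_ball (lambda : R) :
  0 <= lambda -> (forall x, stabilizing_rates vnorm M x lambda) ->
  exists (k : nat) (x0 : 'cV[R]_n) (r : R), 0 < r /\
    forall x, ball x0 r x -> forall t, exists w : t.-tuple 'I_m,
      vnorm (word_product w *m x) <= k%:R * lambda ^+ t.
Proof.
move=> l0 rate.
(* The word may be chosen afresh for each [t], so the union runs over finitely many words and [F k]
   is closed. *)
pose F (k : nat) := (\bigcap_t \bigcup_(w in [set: t.-tuple 'I_m])
  [set x : 'cV[R]_n | vnorm (word_product w *m x) <= k%:R * lambda ^+ t])%classic.
have [k [x0 [r [r0 xF]]]] : exists k x r, 0 < r /\ (ball x r `<=` F k)%classic.
  apply: Baire_closed_cover => [k|x].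
    apply: closed_bigI => t _; apply: closed_bigcup => [|w _].
      exact: finite_finset.
    pose c := k%:R * lambda ^+ t.
    rewrite (_ : [set _ | _]%classic =
      ((fun x => vnorm (word_product w *m x)) @^-1` [set y | y <= c])%classic) //.
    apply: preimage_closed; last exact: closed_le.
    by move=> x _; exact: is_norm_mulmx_continuous.
  have [_ [sigma [c [c0 cb]]]] := rate x.
  exists (Num.trunc (c * vnorm x)).+1 => t _.
  exists [tuple sigma i | i < t] => //=.
  rewrite word_productE -trajectoryE; apply: le_trans (cb t) _.
  by rewrite mulrAC ler_wpM2r ?exprn_ge0 // ltW // truncnS_gt.
exists k, x0, r; split=> // x /xF Fx t.
by have [w _ Hw] := Fx t I; exists w.
Qed.

(** Two grid points served by one word are at least about [r / m ^ t] apart; dividing by this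
    distance costs the factor [m ^ t]. *)
Lemma product_rate (mnorm : 'M[R]_n -> R) (lambda : R) :
  is_norm mnorm -> 0 <= lambda ->
  (forall x, stabilizing_rates vnorm M x lambda) ->
  exists C, forall t, exists2 A, products M t A &
    mnorm A <= C * (m%:R * lambda) ^+ t.
Proof.
move=> hmnorm l0 /(uniform_rate_on_ball l0) [k [x0 [r [r0 kF]]]].
have [C C0 HC] := is_norm_columns hvnorm hmnorm.
exists (C * (k%:R * 4 / r)) => t.
(* One more than the number of words; with spacing [h = r / N] the offsets, at most [h * m ^ t],
   stay below [r]. *)
pose N := (m ^ t).+1.
have NR0 : 0 < N%:R :> R by rewrite ltr0n.
pose h : R := r / N%:R.
have h0 : 0 < h by rewrite divr_gt0.
pose x (g : {ffun 'I_n -> 'I_N}) : 'cV[R]_n := x0 + \col_i (h * (g i)%:R).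
have xr g : ball x0 r (x g).
  rewrite -ball_normE /ball_ /= opprD addNKr normrN.
  apply: (@le_lt_trans _ _ (h * (m ^ t)%:R)).
    apply: mx_norm_le => [|i j]; first by rewrite mulr_ge0 // ltW.
    rewrite mxE (ger0_norm (mulr_ge0 (ltW h0) (ler0n _ _))) ler_pM2l // ler_nat.
    by rewrite -ltnS.
  by rewrite /h mulrAC ltr_pdivrMr // ltr_pM2l // ltr_nat.
have /choice[f Hf] : forall g : {ffun 'I_n -> 'I_N}, exists w : t.-tuple 'I_m,
    vnorm (word_product w *m x g) <= k%:R * lambda ^+ t.
  by move=> g; exact: kF.
have [|w Hw] := grid_pigeonhole f hn.
  by rewrite card_tuple card_ord.
exists (word_product w); first by exists (nth (Ordinal hm) w).
have m0 : 1 <= m%:R ^+ t :> R by rewrite exprn_ege1 // ler1n.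
have lt0 : 0 <= lambda ^+ t by exact: exprn_ge0.
have kr0 : 0 <= k%:R * 4 / r by rewrite divr_ge0 ?mulr_ge0 // ltW.
rewrite -(mulrA C); apply: HC => [|j].
  by rewrite mulr_ge0 // exprn_ge0 // mulr_ge0.
have [g [g' [fg fg' gj gi]]] := Hw j.
(* The two points share [w] and all coordinates but [j], so their difference isolates the basis
   vector. *)
have xx : x g - x g' = (h * ((g j)%:R - (g' j)%:R)) *: delta_mx j 0.
  apply/colP => i; rewrite !mxE eqxx andbT.
  have [->|/gi ->] := eqVneq i j; last by rewrite mulr0; ring.
  by rewrite mulr1; ring.
have gj1 : 1 <= `|(g j)%:R - (g' j)%:R| :> R.
  have /orP[lt|lt] : ((g j < g' j) || (g' j < g j))%N by rewrite -neq_ltn.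
    by rewrite distrC -natrB ?normr_nat ?ler1n ?subn_gt0 // ltnW.
  by rewrite -natrB ?normr_nat ?ler1n ?subn_gt0 // ltnW.
have [vD vZ _] := hvnorm.
have := Hf g; have := Hf g'; rewrite fg fg' => Hg' Hg.
(* The integer coordinates differ by at least 1; the bounds at the two points add up to the factor
   2. *)
have : h * vnorm (word_product w *m delta_mx j 0) <= 2 * (k%:R * lambda ^+ t).
  apply: (@le_trans _ _ (vnorm (word_product w *m (x g - x g')))).
    rewrite xx -scalemxAr vZ normrM (gtr0_norm h0) -(mulrA h) ler_pM2l //.
    by rewrite ler_peMl // is_norm_ge0.
  rewrite mulmxBr; apply: le_trans (vD _ _) _.
  by rewrite is_normN // mulr_natl mulr2n lerD.
rewrite -ler_pdivlMl // => /le_trans; apply.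
(* What remains is [2 * N = 2 * (m ^ t + 1) <= 4 * m ^ t], as [m ^ t >= 1]. *)
rewrite /h invf_div exprMn.
rewrite [leLHS](_ : _ = (k%:R / r * lambda ^+ t) * (2 * N%:R)); last by ring.
rewrite [leRHS](_ : _ = (k%:R / r * lambda ^+ t) * (4 * m%:R ^+ t)); last by ring.
rewrite ler_wpM2l ?mulr_ge0 ?invr_ge0 ?(ltW r0) //.
rewrite /N -[(m ^ t).+1%:R]natr1 natrX; lra.
Qed.

End LowerBound.

(** * The two inequalities *)

Unset Implicit Arguments.

Theorem theorem2p6 (R : realType) (n m : nat) (hn : (2 <= n)%N) (hm : (1 <= m)%N)
    (M : 'I_m -> 'M[R]_n)
    (vnorm : 'cV[R]_n -> R) (hvnorm : is_norm vnorm)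
    (mnorm : 'M[R]_n -> R) (hmnorm : is_norm mnorm) :
  joint_spectral_subradius mnorm M / m%:R <= stabilizability_radius vnorm M /\
  stabilizability_radius vnorm M <= joint_spectral_subradius mnorm M.
Proof.
have [K K0 NK] := is_norm_mulmx hmnorm hmnorm hmnorm.
have [K' K'0 NK'] := is_norm_mulmx hmnorm hvnorm hvnorm.
set rho := joint_spectral_subradius mnorm M.
have lb x : has_lbound (stabilizing_rates vnorm M x) by exists 0 => l [].
(* Above [rho] a single law controls the whole product, hence the trajectory from any [x]. *)
have up x lambda : rho < lambda -> stabilizing_rates vnorm M x lambda.
  move=> rl; split.
    apply: ltW; apply: le_lt_trans rl.
    exact: joint_spectral_subradius_ge0 hmnorm hm _ K0 NK.
  have [sigma [C [C0 NC]]] := joint_spectral_subradius_lt hmnorm hm K0 NK rl.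
  exists sigma, (K' * C); split=> [|t]; first exact: mulr_gt0.
  rewrite trajectoryE; apply: le_trans (NK' _ _) _.
  by rewrite ler_wpM2r ?is_norm_ge0 // -mulrA ler_pM2l.
have ub x : inf (stabilizing_rates vnorm M x) <= rho.
  apply/ler_addgt0Pr => e e0; apply: ge_inf => //; apply: up.
  by rewrite ltrDl.
split; last first.
  by apply: ge_sup => [|_ [x _ <-] //]; exists (inf (stabilizing_rates vnorm M 0)), 0.
have m0 : 0 < m%:R :> R by rewrite ltr0n.
(* The slack [e] allows for infima that are not attained. *)
apply/ler_addgt0Pr => e e0; set s := stabilizability_radius vnorm M.
have sx x : inf (stabilizing_rates vnorm M x) <= s.
  by apply: ub_le_sup; [exists rho => _ [y _ <-] | exists x].
have rne x : (stabilizing_rates vnorm M x !=set0)%classic.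
  by exists (rho + 1); apply: up; rewrite ltrDl.
have s0 : 0 <= s.
  by apply: le_trans (sx 0); apply: lb_le_inf => // l [].
(* The infimum lies below [s + e], so some rate [l] does too, and rates are upward closed. *)
have rate x : stabilizing_rates vnorm M x (s + e).
  have [|l [l0 [sigma [c [c0 cb]]]] ls] := @inf_lt _ _ (s + e) (rne x).
    by apply: le_lt_trans (sx x) _; rewrite ltrDl.
  split; first by rewrite addr_ge0 // ltW.
  exists sigma, c; split=> // t; apply: le_trans (cb t) _.
  rewrite ler_wpM2r ?is_norm_ge0 // ler_pM2l // lerXn2r ?nnegrE ?(ltW ls) //.
  by rewrite addr_ge0 // ltW.
have se0 : 0 <= s + e by rewrite addr_ge0 // ltW.
have [C HC] := product_rate (ltnW hn) hm hvnorm hmnorm se0 rate.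
rewrite ler_pdivrMr // mulrC.
apply: (joint_spectral_subradius_le hmnorm hm K0 NK _ HC).
by rewrite mulr_ge0 // ltW.
Qed.
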